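(* For every integer $k\ge 3$ there exists a $3$-periodic comparator network $M_k$ on $N_k=(2^k-2)(k-2)$ registers which is a $(2k-5)$-pass merger of two sorted sequences given in the odd and even registers, respectively. Its running time is $3(2k-5)=6k-15$ stages, and $6k-15\le 6\log_2 N_k$.
   Context: A comparator network on registers $1,\dots,N$ holds a content $x=(x_1,\dots,x_N)$ of elements of a totally ordered set. A comparator $[a:b]$ with $a<b$ replaces $(x_a,x_b)$ by $(\min(x_a,x_b),\max(x_a,x_b))$. A stage is a set of comparators acting on pairwise disjoint pairs of registers, all applied simultaneously; running time is the number of stages applied. A $3$-periodic network is given by three stages $T_1,T_2,T_3$; one pass applies $T_1$, then $T_2$, then $T_3$, and a $p$-pass computation applies $p$ passes, i.e. $3p$ stages. The network is a $p$-pass merger of two sorted sequences given in odd and even registers if for every input $x$ such that $(x_1,x_3,x_5,\dots)$ and $(x_2,x_4,x_6,\dots)$ are both nondecreasing, the content after $p$ passes is nondecreasing: $x_1\le x_2\le\dots\le x_N$. *)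

(* Defs.v *)
From HB Require Import structures.
From mathcomp Require Import all_boot all_order all_algebra.
From mathcomp Require Import reals exp.

Set Implicit Arguments.
Unset Strict Implicit.
Unset Printing Implicit Defensive.

(* The ordinal i : 'I_N stands for the register numbered i.+1, so that the
   registers are 1, ..., N and parity is that of the register number. *)
Definition reg N (i : 'I_N) : nat := i.+1.

(* The pair (a, b) is the comparator [a:b]. *)
Definition is_stage N (S : {set 'I_N * 'I_N}) : bool :=
  [forall c in S, reg c.1 < reg c.2] &&
  [forall c in S, forall d in S,
     (c != d) ==> [disjoint [set c.1; c.2] & [set d.1; d.2]]].

Record stage N := Stage {
  comparators :> {set 'I_N * 'I_N};
  stageP : is_stage comparators }.

(* All comparators read the old content x. As they are pairwise disjoint, at
   most one of them touches i, so both picks are unambiguous. *)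
Definition apply_stage N d (T : orderType d) (S : stage N)
    (x : {ffun 'I_N -> T}) : {ffun 'I_N -> T} :=
  [ffun i =>
     if [pick c in comparators S | c.1 == i] is Some c
     then Order.min (x c.1) (x c.2)
     else if [pick c in comparators S | c.2 == i] is Some c
     then Order.max (x c.1) (x c.2)
     else x i].

Definition network3 N := 3.-tuple (stage N).

Definition computation N (M : network3 N) (p : nat) : seq (stage N) :=
  flatten (nseq p (tval M)).

Definition running_time N (M : network3 N) (p : nat) : nat :=
  size (computation M p).

Definition run N d (T : orderType d) (M : network3 N) (p : nat)
    (x : {ffun 'I_N -> T}) : {ffun 'I_N -> T} :=
  foldl (fun y S => apply_stage S y) x (computation M p).

Definition nondecreasing_on N d (T : orderType d) (P : pred nat)
    (x : {ffun 'I_N -> T}) : Prop :=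
  forall i j : 'I_N, P (reg i) -> P (reg j) -> reg i <= reg j ->
    (x i <= x j)%O.

Definition odd_even_merger N (M : network3 N) (p : nat) : Prop :=
  forall (d : Order.disp_t) (T : orderType d) (x : {ffun 'I_N -> T}),
    nondecreasing_on odd x ->
    nondecreasing_on (fun n => ~~ odd n) x ->
    nondecreasing_on predT (run M p x).

Definition log2 (R : realType) (x : R) : R := (ln x / ln 2)%R.

Lemma stage_lt N (S : stage N) c : c \in comparators S -> reg c.1 < reg c.2.
Proof. by move=> cS; have /andP[/forall_inP/(_ c cS)] := stageP S. Qed.

Lemma stage_disjoint N (S : stage N) c d i :
  c \in comparators S -> d \in comparators S ->
  i \in [set c.1; c.2] -> i \in [set d.1; d.2] -> c = d.
Proof.
move=> cS dS ic id; apply/eqP; apply: contraT => ncd.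
have /andP[_ /forall_inP/(_ c cS)/forall_inP/(_ d dS)] := stageP S.
by rewrite ncd /= => /disjoint_setI0 /setP/(_ i); rewrite in_setI ic id inE.
Qed.

Lemma apply_stage_min N d (T : orderType d) (S : stage N)
    (x : {ffun 'I_N -> T}) (a b : 'I_N) :
  (a, b) \in comparators S -> apply_stage S x a = Order.min (x a) (x b).
Proof.
move=> abS; rewrite ffunE; case: pickP => [c /andP[cS /eqP ca]|/(_ (a, b))].
  by rewrite (@stage_disjoint _ S c (a, b) a) // !inE ?ca eqxx.
by rewrite abS eqxx.
Qed.

Lemma apply_stage_max N d (T : orderType d) (S : stage N)
    (x : {ffun 'I_N -> T}) (a b : 'I_N) :
  (a, b) \in comparators S -> apply_stage S x b = Order.max (x a) (x b).
Proof.
move=> abS; rewrite ffunE; case: pickP => [c /andP[cS /eqP cb]|_].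
  have e : c = (a, b).
    by apply: (@stage_disjoint _ S _ _ b); rewrite // !inE ?cb eqxx ?orbT.
  by have := stage_lt abS; rewrite -cb e /= ltnn.
case: pickP => [c /andP[cS /eqP cb]|/(_ (a, b))]; last by rewrite abS eqxx.
by rewrite (@stage_disjoint _ S c (a, b) b) // !inE ?cb eqxx orbT.
Qed.

Lemma apply_stage_id N d (T : orderType d) (S : stage N)
    (x : {ffun 'I_N -> T}) (i : 'I_N) :
  (forall c, c \in comparators S -> (c.1 != i) && (c.2 != i)) ->
  apply_stage S x i = x i.
Proof.
move=> off; rewrite ffunE; case: pickP => [c /andP[/off/andP[/negP]]|_] //.
by case: pickP => [c /andP[/off/andP[_ /negP]]|_].
Qed.

(* Main.v *)
Require Import Defs.
From HB Require Import structures.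
From mathcomp Require Import all_boot all_order all_algebra.
From mathcomp Require Import reals exp.
From mathcomp Require Import zify lra.

(* Put m = k - 2 and lay out the registers row by row in a matrix with
   2^(m+1) - 1 rows and 2m columns. Every stage compares whole columns, shifted
   by a row offset, so on a 0-1 input whose columns are sorted the network acts
   on the 2m column heights only; a comparator from column a to column b with
   offset h enforces (height of b) <= (height of a) + h. Up to a constant the
   heights are antisymmetric under mirroring the columns, which leaves m cells.
   The long comparator of cell i joins it to its mirror image with offset
   2^(m-i) - 1. The short comparators are scheduled so that a low value moving
   right meets the long comparator of every cell, hence is roughly halved in
   each, and leaves the last cell as a value in [0, 1] in units of a row.
   Sweeps start once per pass and each pushes the other values one cell to the
   left, so m sweeps bring all cells into [0, 1], and m - 1 further sweeps
   bubble sort them. *)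

Set Implicit Arguments.
Unset Strict Implicit.
Unset Printing Implicit Defensive.

Import Order.TTheory GRing.Theory Num.Theory.

Local Open Scope ring_scope.

(** * The dynamics of the half sequence of column heights *)

Section Sweeps.
Variables (m : nat) (D : nat -> int).

(* Half of an antisymmetric sequence of 2m column heights: a comparator across
   the middle makes the last cell nonnegative, the one wrapping around to the
   next row reflects the first cell at m, and a long comparator between mirror
   columns reflects a cell at - D i.+1. *)
Definition step (t : nat) (y : nat -> int) (i : nat) : int :=
  match ((t + i) %% 3)%N with
  | 0%N => if i is j.+1 then Num.min (y j) (y i)
           else Num.min (y 0%N) (m.*2%:Z - y 0%N)
  | 1%N => Num.max (y i) (- (D i.+1 *+ 2) - y i)
  | _ => if i.+1 == m then `|y i| else Num.max (y i) (y i.+1)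
  end.

Fixpoint cells (y : nat -> int) (t : nat) : nat -> int :=
  if t is t'.+1 then step t' (cells y t') else y.

Lemma step_left t y i : ((t + i.+1) %% 3 = 0)%N ->
  step t y i.+1 = Num.min (y i) (y i.+1).
Proof. by rewrite /step => ->. Qed.

Lemma step_wrap t y : (t %% 3 = 0)%N ->
  step t y 0%N = Num.min (y 0%N) (m.*2%:Z - y 0%N).
Proof. by rewrite /step addn0 => ->. Qed.

Lemma step_long t y i : ((t + i) %% 3 = 1)%N ->
  step t y i = Num.max (y i) (- (D i.+1 *+ 2) - y i).
Proof. by rewrite /step => ->. Qed.

Lemma step_right t y i : ((t + i) %% 3 = 2)%N -> i.+1 != m ->
  step t y i = Num.max (y i) (y i.+1).
Proof. by rewrite /step => -> /negPf ->. Qed.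

Lemma step_mid t y i : ((t + i) %% 3 = 2)%N -> i.+1 = m ->
  step t y i = `|y i|.
Proof. by rewrite /step => -> ->; rewrite eqxx. Qed.

End Sweeps.

(** * Convergence of the cells under successive sweeps *)

Section Trajectory.
Variables (m : nat) (D : nat -> int) (y0 : nat -> int).
Hypothesis D_rec : forall i, (i <= m)%N -> D i = D i.+1 *+ 2 + m%:Z.
Hypothesis D_m : D m = m%:Z.
Hypothesis D_ge0 : forall i, 0 <= D i.
Hypothesis y0_ge : - D 0%N <= y0 0%N.
Let z := cells m D y0.
Hypothesis z_le : forall t i, (i < m)%N -> z t i <= D 0%N + m%:Z.

(* Sweep w carries a low value from cell 0 rightwards, two stages per cell: it
   reaches cell i at time 3 w + 2 i, crosses the long comparator of that cell,
   and leaves to the right. S, P and Q are the contents of cell i before its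
   arrival, before the long comparator, and after it. *)
Let S w i := z (3 * w + 2 * i) i.
Let P w i := z (3 * w + 2 * i).+1 i.
Let Q w i := z (3 * w + 2 * i).+2 i.

Let P_0 w : P w 0 = Num.min (S w 0) (m.*2%:Z - S w 0).
Proof. by rewrite /P /S /z /= step_wrap //; lia. Qed.

Let P_S w i : P w i.+1 = Num.min (Q w i) (S w i.+1).
Proof.
rewrite /P /S /Q /z (_ : 3 * w + 2 * i.+1 = (3 * w + 2 * i).+2)%N; last by lia.
by rewrite [LHS]/= step_left //; lia.
Qed.

Let Q_E w i : Q w i = Num.max (P w i) (- (D i.+1 *+ 2) - P w i).
Proof. by rewrite /P /Q /z [LHS]/= step_long //; lia. Qed.

Let S_S w i : i.+1 != m -> S w.+1 i = Num.max (Q w i) (S w i.+1).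
Proof.
move=> im; rewrite /S /Q /z.
rewrite (_ : 3 * w.+1 + 2 * i = (3 * w + 2 * i).+3)%N; last by lia.
rewrite [LHS]/= step_right //; last by lia.
by rewrite (_ : 3 * w + 2 * i.+1 = (3 * w + 2 * i).+2)%N //; lia.
Qed.

Let S_m w i : i.+1 = m -> S w.+1 i = `|Q w i|.
Proof.
move=> im; rewrite /S /Q /z.
rewrite (_ : 3 * w.+1 + 2 * i = (3 * w + 2 * i).+3)%N; last by lia.
by rewrite [LHS]/= step_mid //; lia.
Qed.

Let Q_ge w i : - D i.+1 <= Q w i.
Proof. rewrite Q_E; lia. Qed.

Let S_ge w i : (i < m)%N -> - D i <= S w i.
Proof.
move=> im; have := @D_rec i (ltnW im); have := D_ge0 i.+1.
case: w => [|w]; last first.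
  have [im1|im1] := eqVneq i.+1 m; first by rewrite S_m //; lia.
  by rewrite S_S //; have := Q_ge w i; lia.
case: i im => [//|i] im.
(* Cell i.+1 has already met its long comparator by time 2 i.+1. *)
rewrite /S /z (_ : 3 * 0 + 2 * i.+1 = (2 * i).+2)%N; last by lia.
rewrite [cells _ _ _ _]/=; set y := cells _ _ _ _.
have [im1|im1] := eqVneq i.+2 m; first by rewrite step_mid //; lia.
by rewrite step_right //; last lia; rewrite step_long; lia.
Qed.

(** By [D_rec], [- D i.+1] is the midpoint of [[- D i, m]], so the long comparator of cell i folds
    this interval onto its upper half [[- D i.+1, m]]. *)
Let P_bound w i : (i < m)%N -> - D i <= P w i <= m%:Z.
Proof.
elim: i => [|i IH] im.
  rewrite P_0; have := @S_ge w _ im.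
  by have := @z_le (3 * w + 2 * 0) _ im; rewrite -/(S w 0); lia.
rewrite P_S Q_E; have := IH (ltnW im); have := @S_ge w _ im.
by have := @D_rec i (ltnW (ltnW im)); have := D_ge0 i.+1; lia.
Qed.

Let Q_le w i : (i < m)%N -> Q w i <= m%:Z.
Proof.
move=> im; rewrite Q_E; have := @P_bound w i im; have := @D_rec i (ltnW im); lia.
Qed.

Let S_small w i : (i < m)%N -> (m <= w + i)%N -> 0 <= S w i <= m%:Z.
Proof.
elim: w i => [|w IH] i im mwi; first by lia.
have := Q_le w im; have := Q_ge w i.
have [im1|im1] := eqVneq i.+1 m; first by rewrite S_m // im1 D_m; lia.
by rewrite S_S //; have := IH i.+1; lia.
Qed.

(* After m sweeps all cells lie in [0, m]; from then on the reflections do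
   nothing and the sweeps are those of bubble sort. *)
Let P_small w i : (i < m)%N -> (m <= w)%N -> 0 <= P w i <= m%:Z.
Proof.
move=> + mw; elim: i => [|i IH] im; first by rewrite P_0; have := @S_small w 0%N; lia.
rewrite P_S Q_E; have := IH (ltnW im); have := @S_small w i.+1; have := D_ge0 i.+1; lia.
Qed.

Let QP w i : (i < m)%N -> (m <= w)%N -> Q w i = P w i.
Proof. by move=> im mw; rewrite Q_E; have := P_small im mw; have := D_ge0 i.+1; lia. Qed.

(** [P w] is now a running minimum. Whatever sweep w leaves in cells 0 to i is at least its minimum
    over cells 0 to [i.+1]. *)
Let PP w i : (i.+1 < m)%N -> (m <= w)%N -> P w i.+1 <= P w.+1 i.
Proof.
move=> + mw; elim: i => [|i IH] im.
  rewrite P_S (P_0 w.+1); have := @S_small w.+1 0%N.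
  by rewrite S_S; last lia; lia.
have := IH (ltnW im); rewrite (P_S w.+1 i) (P_S w i.+1) S_S; last by lia.
by rewrite !QP //; lia.
Qed.

(** Bubble sort: after m sweeps, each further one settles one more cell, from the right. *)
Let SP w i : (i.+1 < m)%N -> (m.*2 <= w + i.+1)%N -> S w i.+1 <= P w i.
Proof.
elim: w i => [|w IH] i im mwi; first by lia.
have := @PP w i im; have : (m <= w)%N by lia.
have [im1|im1] := eqVneq i.+2 m.
  by rewrite S_m // => mw; rewrite QP //; have := P_small im mw; lia.
rewrite S_S // => mw; rewrite QP //.
have := IH i.+1; lia.
Qed.

(** Sweeps overlap in time, so at the final time the cells are in different phases S, P, Q of
    different sweeps. *)
Let phase i : (i < m)%N -> exists w,
  (3 * (m.*2 - 1) = 3 * w + 2 * i \/ 3 * (m.*2 - 1) = (3 * w + 2 * i).+1 \/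
   3 * (m.*2 - 1) = (3 * w + 2 * i).+2)%N.
Proof. by move=> im; exists ((3 * (m.*2 - 1) - 2 * i) %/ 3)%N; lia. Qed.

Lemma cells_final_bound i : (i < m)%N -> 0 <= z (3 * (m.*2 - 1)) i <= m%:Z.
Proof.
move=> im; have [w tE] := phase im.
have := @S_small w i im; have := @P_small w i im; have := @QP w i im.
by rewrite /S /P /Q; case: tE => [|[]] tE; rewrite -tE; lia.
Qed.

Lemma cells_final_mono i : (i.+1 < m)%N ->
  z (3 * (m.*2 - 1)) i.+1 <= z (3 * (m.*2 - 1)) i.
Proof.
move=> im; have [w] := phase (ltnW im).
case: w => [|w]; first by lia.
have wE : (3 * w.+1 + 2 * i = (3 * w + 2 * i.+1).+1)%N by lia.
have := @P_S w i; have := @PP w i im; have := @SP w.+1 i im.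
have := @S_S w i; have := @QP w.+1 i (ltnW im); have := @QP w i.+1 im.
have w1E : (3 * w.+1 + 2 * i.+1 = (3 * w.+1 + 2 * i).+2)%N by lia.
move=> a b c d e f [|[]] tE.
- suff : P w i.+1 <= S w.+1 i by rewrite /P /S -wE -tE.
  lia.
- suff : Q w i.+1 <= P w.+1 i by rewrite /P /Q -wE -tE.
  lia.
- suff : S w.+1 i.+1 <= Q w.+1 i by rewrite /S /Q w1E -tE.
  lia.
Qed.
End Trajectory.

Local Open Scope nat_scope.

(** * Stages that compare whole columns of a matrix *)

Definition row C n := n %/ C.
Definition col C n := n %% C.

Lemma row_col C n : n = row C n * C + col C n.
Proof. exact: divn_eq. Qed.

Lemma row_le C n1 n2 : n1 <= n2 -> row C n1 <= row C n2.
Proof. exact: leq_div2r. Qed.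

Lemma row_lt C H n : n < H * C -> row C n < H.
Proof.
by move=> lt; rewrite ltn_divLR //; case: C lt => [|//]; rewrite muln0.
Qed.

Lemma col_lt C H n : n < H * C -> col C n < C.
Proof. by rewrite ltn_mod; case: C => [|//]; rewrite muln0. Qed.

Lemma row_mkE C r a : a < C -> row C (r * C + a) = r.
Proof. by move=> aC; rewrite /row divnMDl ?divn_small ?addn0 //; case: C aC. Qed.

Lemma col_mkE C r a : a < C -> col C (r * C + a) = a.
Proof. by move=> aC; rewrite /col modnMDl modn_small. Qed.

Section ColumnNetwork.
Variables (N C : nat) (K : nat -> nat -> nat -> bool).
Hypothesis K_col : forall a b h, K a b h -> [/\ a < C, b < C & a != b].
Hypothesis K_inj : forall a b h a' b' h', K a b h -> K a' b' h' ->
  [|| a == a', a == b', b == a' | b == b'] -> [/\ a = a', b = b' & h = h'].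

Definition column_set : {set 'I_N * 'I_N} :=
  [set c : 'I_N * 'I_N |
     (c.1 < c.2) && K (col C c.1) (col C c.2) (row C c.2 - row C c.1)].

Lemma column_set_inj (c d : 'I_N * 'I_N) :
  c \in column_set -> d \in column_set ->
  [|| c.1 == d.1, c.1 == d.2, c.2 == d.1 | c.2 == d.2] -> c = d.
Proof.
case: c d => [n1 n2] [n1' n2']; rewrite !inE /=.
move=> /andP[lt1 K1] /andP[lt2 K2] share.
have {}[a_eq b_eq h_eq] : [/\ col C n1 = col C n1', col C n2 = col C n2'
    & row C n2 - row C n1 = row C n2' - row C n1'].
  apply: K_inj K1 K2 _.
  by case/or4P: share => /eqP->; rewrite eqxx ?orbT.
have [_ _ nab] := K_col K1.
have le1 := row_le C (ltnW lt1); have le2 := row_le C (ltnW lt2).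
have rows : row C n1 = row C n1'.
  case/or4P: share => /eqP e; first by rewrite e.
  - by rewrite e -b_eq eqxx in nab.
  - by rewrite e -a_eq eqxx in nab.
  - by move: h_eq le1 le2; rewrite e; lia.
have e1 : n1 = n1'.
  by apply: val_inj; rewrite /= (row_col C n1) (row_col C n1') rows a_eq.
have e2 : n2 = n2'.
  apply: val_inj; rewrite /= (row_col C n2) (row_col C n2') b_eq.
  by congr (_ * _ + _); lia.
by rewrite e1 e2.
Qed.

Lemma column_stageP : is_stage column_set.
Proof.
apply/andP; split; apply/forall_inP => c cS;
  first by move: cS; rewrite inE => /andP[].
apply/forall_inP => d dS; apply/implyP; apply: contraNT => /pred0Pn[i /=].
rewrite !inE => /andP[ic id]; apply/eqP; apply: column_set_inj cS dS _.
by case/orP: ic => /eqP<-; case/orP: id => /eqP<-; rewrite eqxx ?orbT.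
Qed.

Definition column_stage : stage N := Stage column_stageP.

(* Columns read from top to bottom are zeros then ones. Row r of column a holds
   a zero iff C (r + 1) <= G a, so the number of zeros of the column is the
   floor of G a / C; fractional heights are stable under comparators since
   max, min and integer shifts commute with the floor. *)
Definition column_content (G : nat -> int) : {ffun 'I_N -> bool} :=
  [ffun n : 'I_N => ~~ ((C * (row C n).+1)%:Z <= G (col C n))%R].

Variable H : nat.
Hypothesis N_E : N = H * C.
Hypothesis K_up : forall a b h, K a b h -> (a < b) || (0 < h).
Hypothesis K_cover : forall a, a < C -> exists b h, K a b h \/ K b a h.
Variables G G' : nat -> int.
Hypothesis G_bound : forall a, a < C -> (0 <= G a < (C * H.+1)%:Z)%R.
Hypothesis G_K : forall a b h, K a b h ->
  G' a = Num.max (G a) (G b - (C * h)%:Z)%R /\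
  G' b = Num.min (G b) (G a + (C * h)%:Z)%R.

Lemma register_lt r b : r < H -> b < C -> r * C + b < N.
Proof.
by move=> rH bC; rewrite N_E; have := leq_mul2r C r.+1 H; rewrite rH mulSn; lia.
Qed.

Lemma apply_column_stage :
  apply_stage column_stage (column_content G) = column_content G'.
Proof.
apply/ffunP => n.
have rH : row C n < H by apply: row_lt; rewrite -N_E.
have aC : col C n < C by apply: (@col_lt C H); rewrite -N_E.
have nE := row_col C n; set r := row C n in rH nE *; set a := col C n in aC nE *.
have [b [h [abK|baK]]] := K_cover aC.
- have [_ bC nab] := K_col abK; have [GA _] := G_K abK.
  have [rhH|Hrh] := ltnP (r + h) H.
    have [rE bE] := (row_mkE (r + h) bC, col_mkE (r + h) bC).
    pose n2 := Ordinal (register_lt rhH bC).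
    have n2E : n2 = (r + h) * C + b :> nat by [].
    rewrite (@apply_stage_min _ _ _ _ _ n n2); last first.
      rewrite inE [in X in _ && X]n2E rE bE -/r -/a addKn abK andbT n2E nE mulnDl.
      by have := K_up abK; case: (h) => [|h']; rewrite ?mulSn; lia.
    rewrite !ffunE n2E rE bE -/r -/a GA.
    by have := mulnDr C r.+1 h; rewrite addSn; lia.
  (* The partner row lies below the matrix; as [G b < C (H + 1)], the maximum leaves this entry
     unchanged. *)
  rewrite apply_stage_id ?ffunE -/r -/a ?GA.
    have := mulnDr C r.+1 h; have := leq_mul2l C H.+1 (r.+1 + h).
    by have := G_bound bC; lia.
  move=> [n1 n2]; rewrite inE /= => /andP[lt K1].
  have le := row_le C (ltnW lt); apply/andP; split; apply/eqP => e.
    have [|_ _ hE] := K_inj abK K1; first by rewrite e eqxx.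
    have : row C n2 < H by apply: row_lt; rewrite -N_E.
    by move: hE le; rewrite e -/r; lia.
  have [|aE bE _] := K_inj abK K1; first by rewrite e eqxx !orbT.
  by rewrite bE e eqxx in nab.
- have [bC _ nab] := K_col baK; have [_ GA] := G_K baK.
  have [hr|rh] := leqP h r.
    have rhH : r - h < H by lia.
    have [rE bE] := (row_mkE (r - h) bC, col_mkE (r - h) bC).
    pose n1 := Ordinal (register_lt rhH bC).
    have n1E : n1 = (r - h) * C + b :> nat by [].
    rewrite (@apply_stage_max _ _ _ _ _ n1 n); last first.
      rewrite inE [in X in _ && X]n1E rE bE -/r -/a subKn // baK andbT.
      rewrite n1E nE -{2}(subnK hr) mulnDl.
      by have := K_up baK; case: (h) => [|h']; rewrite ?mulSn; lia.
    rewrite !ffunE n1E rE bE -/r -/a GA.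
    by have := mulnDr C (r - h).+1 h; rewrite addSn subnK //; lia.
  rewrite apply_stage_id ?ffunE -/r -/a ?GA.
    by have := leq_mul2l C r.+1 h; have := G_bound bC; lia.
  move=> [n1 n2]; rewrite inE /= => /andP[lt K1].
  have le := row_le C (ltnW lt); apply/andP; split; apply/eqP => e.
    have [|aE bE _] := K_inj K1 baK; first by rewrite e eqxx !orbT.
    by rewrite -aE e eqxx in nab.
  have [|_ _ hE] := K_inj baK K1; first by rewrite e eqxx !orbT.
  by move: hE le; rewrite e -/r; lia.
Qed.
End ColumnNetwork.

(** * The zero-one principle *)

Section ZeroOne.
Variables (N : nat) (d d' : Order.disp_t) (T : orderType d) (T' : orderType d').
Variable f : T -> T'.
Hypothesis f_homo : {homo f : x y / (x <= y)%O}.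

Let f_min x y : f (Order.min x y) = Order.min (f x) (f y).
Proof. by case: leP => [|/ltW] /f_homo fxy; rewrite ?(min_l fxy) ?(min_r fxy). Qed.

Let f_max x y : f (Order.max x y) = Order.max (f x) (f y).
Proof. by case: leP => [|/ltW] /f_homo fxy; rewrite ?(max_l fxy) ?(max_r fxy). Qed.

Lemma apply_stage_homo (S : stage N) (x : {ffun 'I_N -> T}) :
  apply_stage S [ffun i => f (x i)] = [ffun i => f (apply_stage S x i)].
Proof.
apply/ffunP => i; rewrite !ffunE; case: pickP => [c _|_]; first by rewrite f_min ?ffunE.
by case: pickP => [c _|_]; rewrite ?f_max ?ffunE.
Qed.

Lemma run_homo (M : network3 N) p (x : {ffun 'I_N -> T}) :
  run M p [ffun i => f (x i)] = [ffun i => f (run M p x i)].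
Proof.
rewrite /run; elim: (computation M p) x => [|S c IH] x //=.
by rewrite apply_stage_homo IH.
Qed.
End ZeroOne.

Lemma zero_one_merger N (M : network3 N) p :
  (forall x : {ffun 'I_N -> bool}, nondecreasing_on odd x ->
     nondecreasing_on (fun n => ~~ odd n) x -> nondecreasing_on predT (run M p x)) ->
  odd_even_merger M p.
Proof.
move=> bool_merger d T x x_odd x_even i j _ _ ij; rewrite leNgt; apply/negP => gt_ij.
(* Thresholding just above the output at j keeps the inversion at i, j. *)
pose f v := (run M p x j < v)%O.
have f_homo : {homo f : u v / (u <= v)%O}.
  by move=> u v uv; rewrite /f leEbool; case: ltP => //= ju; rewrite (lt_le_trans ju uv).
have f_nd P : nondecreasing_on P x -> nondecreasing_on P [ffun i => f (x i)].
  by move=> xP a b pa pb ab; rewrite !ffunE; apply: f_homo; apply: xP.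
have := bool_merger _ (f_nd _ x_odd) (f_nd _ x_even) i j isT isT ij.
by rewrite (run_homo f_homo) !ffunE /f ltxx gt_ij.
Qed.

Lemma bool_threshold L (f : nat -> bool) :
  (forall i j, i <= j -> j < L -> f i -> f j) ->
  exists2 p, p <= L & forall i, i < L -> f i = (p <= i).
Proof.
elim: L => [|L IH] f_homo; first by exists 0.
have [|p pL fE] := IH; first by move=> i j ij jL; apply: f_homo => //; exact: ltnW.
have [p_eq|p_neq] := eqVneq p L; last first.
  exists p => [|i]; first exact: leqW.
  rewrite ltnS leq_eqVlt => /predU1P[->|/fE//].
  by rewrite pL; apply: (f_homo p) => //; rewrite fE //; lia.
exists (if f L then L else L.+1) => [|i]; first by case: ifP.
rewrite ltnS leq_eqVlt => /predU1P[->|iL].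
  by case: ifP => _; rewrite ?leqnn ?ltnn.
by rewrite fE //; case: ifP => _; lia.
Qed.

Lemma mod3_cases t : [\/ t %% 3 = 0, t %% 3 = 1 | t %% 3 = 2].
Proof.
by case: (t %% 3) (ltn_pmod t (isT : 0 < 3)) => [|[|[|]]] // _;
  [exact: Or31 | exact: Or32 | exact: Or33].
Qed.

(** * The merging network and its correctness *)

Section Merger.
Variable m : nat.
Hypothesis m_gt0 : 0 < m.

Definition reach a := 2 ^ (m - a) - 1.

(* link t a b h: stage t compares (r, a) with (r + h, b) for every row r. The
   edges between neighbouring columns are numbered 0 .. m .. 0 from the
   wrap-around edge to the middle and back, and edge j is active at t = - j
   modulo 3; the long comparator of a column takes the remaining stage. *)
Definition link t a b h : bool :=
  [|| [&& a.+1 == b, b < m.*2, h == 0 & (t + minn b (m.*2 - b)) %% 3 == 0],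
      [&& a == m.*2.-1, b == 0, h == 1 & t %% 3 == 0]
    | [&& a < m, a + b == m.*2.-1, h == reach a & (t + a) %% 3 == 1]].

Lemma link_col t a b h : link t a b h -> [/\ a < m.*2, b < m.*2 & a != b].
Proof. by rewrite /link; split; lia. Qed.

Lemma link_up t a b h : link t a b h -> (a < b) || (0 < h).
Proof. by rewrite /link; lia. Qed.

Lemma link_inj t a b h a' b' h' : link t a b h -> link t a' b' h' ->
  [|| a == a', a == b', b == a' | b == b'] -> [/\ a = a', b = b' & h = h'].
Proof.
move=> l1 l2 share; have [ea eb] : a = a' /\ b = b' by move: l1 l2; rewrite /link; lia.
by subst; split=> //; move: l1 l2; rewrite /link; lia.
Qed.

Lemma link_cover t a : a < m.*2 -> exists b h, link t a b h \/ link t b a h.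
Proof.
rewrite /link => aC; have [am|ma] := ltnP a m.
  have [e|e|e] := mod3_cases (t + a).
  - by case: a aC am e => [|a] aC am e; [exists m.*2.-1, 1 | exists a, 0]; right; lia.
  - by exists (m.*2.-1 - a), (reach a); left; lia.
  - by exists a.+1, 0; left; lia.
have [i iE] : exists i, i = m.*2.-1 - a by exists (m.*2.-1 - a).
have [e|e|e] := mod3_cases (t + i).
- have [i0|i0] := posnP i; [exists 0, 1 | exists a.+1, 0]; left; lia.
- by exists i, (reach i); right; lia.
- by exists a.-1, 0; right; lia.
Qed.

Definition rows := 2 ^ m.+1 - 1.
Variable N : nat.
Hypothesis N_E : N = rows * m.*2.

Definition merger_stage t : stage N :=
  column_stage N (@link_col t) (@link_inj t).

Definition merger : network3 N :=
  [tuple merger_stage 0; merger_stage 1; merger_stage 2].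

Definition mirror (y : nat -> int) (a : nat) : int :=
  (if (a < m)%N then y a else - y (m.*2.-1 - a)%N)%R.

(** The solution of [D i = 2 D i.+1 + m], [D m = m]. A row has height 2m, so [reach i] rows amount
    to [2 depth i.+1]. *)
Definition depth i : int := ((m * (2 ^ (m.+1 - i) - 1))%N%:Z)%R.

Definition content (s : nat) (y : nat -> int) : {ffun 'I_N -> bool} :=
  column_content N m.*2 (fun a => s%:Z + mirror y a)%R.

(** A reflection only moves a value lying beyond its centre as seen from 0, so absolute values do
    not grow. *)
Lemma step_bound (B : int) t y : (forall i, (i < m)%N -> `|y i| <= B)%R ->
  (forall i, (i < m)%N -> `|step m depth t y i| <= B)%R.
Proof.
move=> yB i im; rewrite /step; have := yB i im.
case: (_ %% _) => [|[|_]].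
- case: i im => [|i] im; first by lia.
  by have := yB i (ltnW im); lia.
- by rewrite /depth; lia.
- by case: eqP => [|ne]; [lia | have := yB i.+1; lia].
Qed.

Lemma apply_merger_stage s (B : int) t t' y :
  t = t' %[mod 3] ->
  (forall i, (i < m)%N -> `|y i| <= B)%R ->
  (B <= s%:Z)%R -> (s%:Z + B < (m.*2 * rows.+1)%N%:Z)%R ->
  apply_stage (merger_stage t) (content s y) = content s (step m depth t' y).
Proof.
move=> tE yB Bs sB.
apply: (@apply_column_stage _ _ _ _ _ rows N_E (@link_up t) (@link_cover t)).
  move=> a aC; rewrite /mirror; case: ifP => am; first by have := yB a; lia.
  by have := yB (m.*2.-1 - a); lia.
move=> a b h /or3P[] /and4P[].
- move=> /eqP<- bC /eqP-> ph; rewrite /mirror muln0.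
  have [bm|mb|bm] := ltngtP a.+1 m.
  + by rewrite step_right ?step_left; lia.
  (* In the right half the signs are reversed, which exchanges minimum and maximum. *)
  + have jE : (m.*2.-1 - a = (m.*2.-1 - a.+1).+1)%N by lia.
    by rewrite jE step_left ?step_right; lia.
  + have -> : (m.*2.-1 - a.+1 = a)%N by lia.
    by rewrite step_mid //; lia.
- move=> /eqP-> /eqP-> /eqP-> ph; rewrite /mirror m_gt0 subnn muln1.
  have -> : (m.*2.-1 < m)%N = false by lia.
  by rewrite step_wrap; lia.
- move=> am /eqP abE /eqP-> ph; rewrite /mirror am.
  have -> : (b < m)%N = false by lia.
  have -> : (m.*2.-1 - b = a)%N by lia.
  have -> : ((m.*2 * reach a)%N%:Z)%R = (depth a.+1 *+ 2)%R.
    by rewrite /depth subSS -/(reach a) -mul2n -mulnA; lia.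
  by rewrite step_long; lia.
Qed.

Lemma run_merger s (B : int) y p :
  (forall i, (i < m)%N -> `|y i| <= B)%R ->
  (B <= s%:Z)%R -> (s%:Z + B < (m.*2 * rows.+1)%N%:Z)%R ->
  run merger p (content s y) = content s (cells m depth y (3 * p)).
Proof.
move=> yB Bs sB.
have zB t i : i < m -> (`|cells m depth y t i| <= B)%R.
  by elim: t i => [|t IH]; [exact: yB | exact: step_bound].
have stepE t' t : t = t' %[mod 3] -> apply_stage (merger_stage t)
    (content s (cells m depth y t')) = content s (cells m depth y t'.+1).
  by move=> tE; apply: (apply_merger_stage tE (zB t')).
rewrite /run /computation.
suff gen q : foldl (fun y S => apply_stage S y)
    (content s (cells m depth y (3 * q))) (flatten (nseq p (tval merger))) = content s (cells m depth y (3 * (q + p))).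
  exact: (gen 0).
elim: p q => [|p IH] q; first by rewrite addn0.
rewrite /= (stepE (3 * q) 0) ?(stepE (3 * q).+1 1) ?(stepE (3 * q).+2 2); try lia.
by rewrite (_ : (3 * q).+3 = 3 * q.+1) ?IH ?addSnnS //; lia.
Qed.

(** All heights lie within m of s, a window of one row, so at most one row is mixed; it is sorted
    because heights decrease from left to right. *)
Lemma content_sorted s y :
  (forall i, (i < m)%N -> 0 <= y i <= m%:Z)%R ->
  (forall i, (i.+1 < m)%N -> y i.+1 <= y i)%R ->
  nondecreasing_on predT (content s y).
Proof.
move=> y_bound y_mono.
have mono i j : i <= j -> j < m -> (y j <= y i)%R.
  move=> ij jm; elim: j ij jm => [|j IH]; first by rewrite leqn0 => /eqP->.
  rewrite leq_eqVlt => /predU1P[->//|ij] jm.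
  by apply: le_trans (IH ij (ltnW jm)); exact: y_mono.
have mir_mono a b : a <= b -> b < m.*2 -> (mirror y b <= mirror y a)%R.
  move=> ab bC; rewrite /mirror; case: (ltnP b m) => bm.
    by rewrite (leq_ltn_trans ab bm); exact: mono.
  case: ltnP => am; last by have := mono (m.*2.-1 - b) (m.*2.-1 - a); lia.
  by have := y_bound a am; have := y_bound (m.*2.-1 - b); lia.
have mir_bound a : a < m.*2 -> (`|mirror y a| <= m%:Z)%R.
  move=> aC; rewrite /mirror; case: ltnP => am; first by have := y_bound a am; lia.
  by have := y_bound (m.*2.-1 - a); lia.
move=> i j _ _; rewrite /reg ltnS => ij.
suff zero_mono : ((m.*2 * (row m.*2 j).+1)%N%:Z <= s%:Z + mirror y (col m.*2 j) ->
    (m.*2 * (row m.*2 i).+1)%N%:Z <= s%:Z + mirror y (col m.*2 i))%R.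
  rewrite !ffunE leEbool; move: zero_mono.
  by case: (_ <= _)%R; case: (_ <= _)%R => // /(_ isT).
have iC : col m.*2 i < m.*2 by apply: (@col_lt _ rows); rewrite -N_E.
have jC : col m.*2 j < m.*2 by apply: (@col_lt _ rows); rewrite -N_E.
have := row_le m.*2 ij; rewrite leq_eqVlt => /predU1P[rE|].
  have : col m.*2 i <= col m.*2 j.
    by have := row_col m.*2 i; have := row_col m.*2 j; rewrite rE; lia.
  by move=> /mir_mono/(_ jC); rewrite rE; lia.
rewrite -(leq_pmul2l (n1 := (row _ _).+1) (m := m.*2)); last by lia.
have := mulnS m.*2 (row m.*2 j); have := mulnS m.*2 (row m.*2 i).
have := mir_bound _ iC; have := mir_bound _ jC; lia.
Qed.

Lemma merger_correct : odd_even_merger merger (m.*2 - 1).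
Proof.
apply: zero_one_merger => x x_odd x_even.
(* Index n is register n + 1, so odd indices are the even registers. The default [true] is never
   read below N. *)
pose xx n := oapp x true (insub n).
have xxE (n : 'I_N) : xx n = x n by rewrite /xx valK.
have NE2 : N = (rows * m).*2 by rewrite N_E doubleMr.
have xx_homo (c : bool) i j : i <= j -> j < rows * m -> xx (i.*2 + c) -> xx (j.*2 + c).
  move=> ij jL.
  have jN : j.*2 + c < N by rewrite NE2; case: c; lia.
  have iN : i.*2 + c < N by rewrite NE2; case: (c); lia.
  rewrite (xxE (Ordinal iN)) (xxE (Ordinal jN)).
  have : (x (Ordinal iN) <= x (Ordinal jN))%O.
    case: c jN iN => jN iN; [apply: x_even | apply: x_odd]; rewrite /reg /=; lia.
  by rewrite leEbool; do 2 case: (x _).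
have [p pL pE] := bool_threshold (xx_homo false).
have [q qL qE] := bool_threshold (xx_homo true).
(* Column a has floor (g / m) zeros, where g = p + m - 1 - a / 2 for a even and
   g = q + m - 1 - (a - 1) / 2 for a odd. The sum of two mirror values of g is
   always s, so 2 g - s is antisymmetric, while the integer heights need not
   be so up to a constant. *)
pose y (i : nat) : int := (if odd i then q%:Z - p%:Z + m%:Z - i%:Z
                           else p%:Z - q%:Z + m%:Z - 1 - i%:Z)%R.
pose s := p + q + m.-1.
have xE : x = content s y.
  apply/ffunP => n; rewrite -xxE ffunE.
  have aC : col m.*2 n < m.*2 by apply: (@col_lt _ rows); rewrite -N_E.
  have nE := row_col m.*2 n.
  have -> : mirror y (col m.*2 n) =
     (if odd (col m.*2 n) then q%:Z - p%:Z + m%:Z - (col m.*2 n)%:Z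
      else p%:Z - q%:Z + m%:Z - 1 - (col m.*2 n)%:Z)%R.
    rewrite /mirror /y; case: ltnP => // am.
    by have [] := boolP (odd (col m.*2 n)); case: ifP; lia.
  have nL : n./2 < rows * m by have := ltn_ord n; rewrite [X in _ < X]NE2; lia.
  have -> : xx n = if odd n then q <= n./2 else p <= n./2.
    rewrite -{1}(odd_double_half n) addnC.
    by case: (odd n); [exact: qE | exact: pE].
  have cE : m.*2 * (row m.*2 n).+1 = (row m.*2 n * m).*2 + m.*2.
    by rewrite mulnS -doubleMl mulnC addnC.
  have odd_n : odd n = odd (col m.*2 n).
    by rewrite {1}nE oddD oddM odd_double andbF.
  rewrite cE odd_n; move: nE; rewrite -doubleMr /s.
  by have [] := boolP (odd (col m.*2 n)); lia.
have capE : m.*2 * rows.+1 = (rows * m).*2 + m.*2 by rewrite mulnS -doubleMl mulnC addnC.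
have depthE : depth 0 = (rows * m)%N%:Z%R by rewrite /depth subn0 mulnC.
(* The smaller distance from s to the ends of the admissible range from 0 to [2m (rows + 1) - 1]. *)
pose B : int := (if (p + q <= rows * m)%N then s%:Z
  else (rows * m + m).*2%:Z - s%:Z - 1)%R.
have yB i : i < m -> (`|y i| <= B)%R.
  by move=> im; rewrite /y /B /s; case: ifP; case: ifP; lia.
have y0 : (- depth 0 <= y 0%N)%R by rewrite depthE /y /=; lia.
have BD : (B <= depth 0 + m%:Z)%R by rewrite depthE /B /s; case: ifP; lia.
have Bs : (B <= s%:Z)%R by rewrite /B /s; case: ifP; lia.
have sB : (s%:Z + B < (m.*2 * rows.+1)%N%:Z)%R by rewrite capE /B /s; case: ifP; lia.
rewrite xE (run_merger _ yB Bs sB).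
have D_rec i : i <= m -> depth i = (depth i.+1 *+ 2 + m%:Z)%R.
  move=> im; rewrite /depth subSn // subSS expnS.
  by case: (2 ^ (m - i)) (expn_gt0 2 (m - i)) => // e _; nia.
have D_m : depth m = (m%:Z)%R by rewrite /depth subSnn muln1.
have D_ge0 i : (0 <= depth i)%R by [].
have z_le t i : i < m -> (cells m depth y t i <= depth 0 + m%:Z)%R.
  move=> im; apply: le_trans BD; apply: le_trans (ler_norm _) _.
  by elim: t i im => [|t IH]; [exact: yB | exact: step_bound].
apply: content_sorted => i im.
  exact: (cells_final_bound D_rec D_m D_ge0 y0 z_le).
exact: (cells_final_mono D_rec D_m D_ge0 y0 z_le).
Qed.
End Merger.

(** * The logarithmic bound and the final assembly *)

Lemma log2_ge (R : realType) (n N : nat) :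
  2 ^ n <= N -> (n%:R <= log2 (N%:R : R))%R.
Proof.
move=> nN; rewrite /log2 ler_pdivlMr; last by rewrite ln_gt0 // ltr1n.
rewrite mulr_natl -lnXn // ler_ln ?posrE ?exprn_gt0 ?ltr0n //; last first.
  by apply: leq_trans nN; rewrite expn_gt0.
by rewrite -natrX ler_nat.
Qed.

Theorem theorem1 (k : nat) (hk : 3 <= k) :
  let N := (2 ^ k - 2) * (k - 2) in
  exists M : network3 N,
    [/\ odd_even_merger M (2 * k - 5),
        running_time M (2 * k - 5) = 3 * (2 * k - 5),
        3 * (2 * k - 5) = 6 * k - 15 &
        forall R : realType,
          (6 * k%:R - 15 <= 6 * log2 (N%:R : R))%R].
Proof.
move=> N; have m_gt0 : 0 < k - 2 by lia.
have kE : k = (k - 2).+2 by lia.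
have N_E : N = rows (k - 2) * (k - 2).*2.
  have p2 : 2 ^ k = 2 * 2 ^ (k - 2).+1 by rewrite -expnS -kE.
  by rewrite /N /rows -doubleMr doubleMl; congr (_ * _); lia.
exists (merger m_gt0 N); split.
- have -> : 2 * k - 5 = (k - 2).*2 - 1 by lia.
  exact: merger_correct.
- by rewrite /running_time size_flatten /shape map_nseq sumn_nseq size_tuple.
- by lia.
(* As [6k - 15 <= 6(k - 1)], the bound [2^(k-1) <= 2^k - 2 <= N] suffices. *)
- move=> R; suff : (k.-1%:R <= log2 (N%:R : R))%R.
    have -> : (k%:R = k.-1%:R + 1 :> R)%R by rewrite natr1 prednK // (ltnW (ltnW hk)).
    lra.
  apply: log2_ge; apply: (@leq_trans (2 ^ k - 2)); last by rewrite leq_pmulr.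
  rewrite -{2}(prednK (ltnW (ltnW hk))) expnS.
  have k_gt1 : 0 < k.-1 by lia.
  by have := leq_pexp2l (isT : 0 < 2) k_gt1; lia.
Qed.
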